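(* For all integers $n\ge 0$, $$\sum_{k=0}^n (-1)^k\,E(n,k)\binom{2n+1}{k+1}^{-1}=2B_{n+1},$$ where $E(n,k)$ are the second-order Eulerian numbers and $B_m$ is the $m$th Bernoulli number with the convention $B_1=\tfrac12$.
   Context: The second-order Eulerian numbers $E(n,k)=\left\langle\!\left\langle {n\atop k}\right\rangle\!\right\rangle$ are defined for integers $n\ge 0$ and $k$ by $E(0,k)=\delta_{k,0}$ (Kronecker delta) and $E(n+1,k)=(k+1)E(n,k)+(2n+1-k)E(n,k-1)$. *)

(* Defs.v *)
From mathcomp Require Import all_boot all_order all_algebra.
Set Implicit Arguments. Unset Strict Implicit. Unset Printing Implicit Defensive.
Import Order.TTheory GRing.Theory Num.Theory.
Local Open Scope ring_scope.

Fixpoint eulerian2 (n : nat) (k : int) : int :=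
  if n is m.+1 then
    (k + 1) * eulerian2 m k + ((2 * m + 1)%N%:Z - k) * eulerian2 m (k - 1)
  else (k == 0)%:R.

(* bernoulli_seq n = [:: B_0; ...; B_(n-1)].  Comparing coefficients in
   (exp t - 1) * \sum_n B_n t^n / n! = t * exp t, the generating function
   identity for the convention B_1 = 1/2, gives
   \sum_(k <= m) 'C(m + 1, k) B_k = m + 1, which is solved here for B_m. *)
Fixpoint bernoulli_seq (n : nat) : seq rat :=
  if n is m.+1 then
    let s := bernoulli_seq m in
    rcons s (1 - (\sum_(k < m) 'C(m.+1, k)%:R * s`_k) / m.+1%:R)
  else [::].

Definition bernoulli_num (n : nat) : rat := (bernoulli_seq n.+1)`_n.

Lemma size_bernoulli_seq n : size (bernoulli_seq n) = n.
Proof. by elim: n => //= n IHn; rewrite size_rcons IHn. Qed.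

Lemma nth_bernoulli_seq n k : (k < n)%N -> (bernoulli_seq n)`_k = bernoulli_num k.
Proof.
elim: n => // n IHn; rewrite ltnS leq_eqVlt => /predU1P[-> //|lt_kn].
by rewrite /= nth_rcons size_bernoulli_seq lt_kn IHn.
Qed.

Lemma bernoulli_num_rec n :
  \sum_(k < n.+1) 'C(n.+1, k)%:R * bernoulli_num k = n.+1%:R.
Proof.
rewrite big_ord_recr /= binSn {2}/bernoulli_num /= nth_rcons size_bernoulli_seq.
rewrite ltnn eqxx; under [X in _ * (1 - X / _)]eq_bigr => k _ do
  rewrite nth_bernoulli_seq //.
by rewrite mulrBr mulr1 mulrCA divff ?pnatr_eq0 // mulr1 addrC subrK.
Qed.

Lemma bernoulli_num1 : bernoulli_num 1 = 2^-1.
Proof. by rewrite /bernoulli_num /= big_ord1 big_ord0. Qed.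

(* Main.v *)
(** By the beta integral the left-hand side is [(2n+2) \int_0^1 R_n dx], where
    [R_n = \sum_k (-1)^k E(n,k) x^(k+1) (1-x)^(2n-k)] satisfies
    [R_(n+1) = x (1-x)^2 R_n'].  The same recurrence gives, for [n >= 1],
    [R_n = \sum_k (-1)^(k+1) ((n+k)!/k!) e(n,k) x^k (1-x)^(n+1)] with
    [e(n,k) = [t^n] ((exp t - 1)/t - 1)^k].  Integrating, and using
    [(n+1+k) e(n+1,k) = k (e(n,k) + e(n,k-1))], the integral telescopes to
    [(n+1)! \sum_(k >= 1) (-1)^(k-1) e(n+1,k) / k], which divided by [(n+1)!] is
    the [t^(n+1)] coefficient of [log ((exp t - 1)/t)]; the derivative of this
    logarithm is [\sum_n B_(n+1) t^n / (n+1)!]. *)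
Require Import Defs.
From HB Require Import structures.
From mathcomp Require Import all_boot all_order all_algebra.
From mathcomp Require Import ring zify.
Import Order.TTheory GRing.Theory Num.Theory.
Local Open Scope ring_scope.

Lemma natf_neq0 (n : nat) : (n`!%:R : rat) != 0.
Proof. by rewrite pnatr_eq0 -lt0n fact_gt0. Qed.

Lemma bin_fact_rat (n m : nat) : (m <= n)%N ->
  'C(n, m)%:R * (m`!%:R * (n - m)`!%:R) = n`!%:R :> rat.
Proof. by move=> le_mn; rewrite -(bin_fact le_mn) -!natrM. Qed.

Lemma factS_rat (n : nat) : (n.+1)`!%:R = n.+1%:R * n`!%:R :> rat.
Proof. by rewrite factS natrM. Qed.

(** * Integration over [0,1] and the beta integral *)

Definition integral01 (p : {poly rat}) : rat := \sum_(i < size p) p`_i / i.+1%:R.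

Lemma integral01_widen (N : nat) (p : {poly rat}) : (size p <= N)%N ->
  integral01 p = \sum_(i < N) p`_i / i.+1%:R.
Proof.
move=> le_pN; rewrite /integral01 (big_ord_widen _ (fun i => p`_i / i.+1%:R) le_pN).
rewrite big_mkcond; apply: eq_bigr => i _; case: ltnP => // le_pi.
by rewrite nth_default ?mul0r.
Qed.

Lemma integral01_is_linear : scalar integral01.
Proof.
move=> a p q; pose N := maxn (size p) (size q).
have le_pN : (size p <= N)%N by exact: leq_maxl.
have le_qN : (size q <= N)%N by exact: leq_maxr.
have le_sN : (size (a *: p + q)%R <= N)%N.
  by rewrite (leq_trans (size_polyD _ _)) // geq_max le_qN (leq_trans (size_scale_leq _ _)).
rewrite !(integral01_widen N) // mulr_sumr -big_split /=.
by apply: eq_bigr => i _; rewrite coefD coefZ mulrDl mulrA.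
Qed.

HB.instance Definition _ :=
  GRing.isLinear.Build rat {poly rat} rat *%R integral01 integral01_is_linear.

Lemma integral01_deriv (p : {poly rat}) : integral01 p^`() = p.[1] - p.[0].
Proof.
have le_dp : (size p^`() <= size p)%N.
  by have [->|/lt_size_deriv/ltnW//] := eqVneq p 0; rewrite deriv0.
rewrite (integral01_widen _ _ le_dp) horner_coef0.
have -> : p.[1] = \sum_(i < (size p).+1) p`_i.
  rewrite big_ord_recr /= [p`_(size p)]nth_default // addr0 horner_coef.
  by apply: eq_bigr => i _; rewrite expr1n mulr1.
rewrite big_ord_recl addrC addKr; apply: eq_bigr => i _.
by rewrite coef_deriv -(mulr_natr p`_i.+1) mulfK // pnatr_eq0.
Qed.

(** Integration by parts, by induction on [b]: the derivative of ['X^(a.+1) * (1 - 'X) ^+ b.+1]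
    integrates to 0, which trades a factor [1 - 'X] for a factor ['X]. *)
Lemma beta01 (a b : nat) :
  integral01 ('X^a * (1 - 'X) ^+ b) = a`!%:R * b`!%:R / (a + b).+1`!%:R.
Proof.
elim: b a => [|b IHb] a.
  have D : ('X^(a.+1) : {poly rat})^`() = a.+1%:R *: ('X^a : {poly rat}).
    by rewrite derivXn scaler_nat.
  have := integral01_deriv 'X^(a.+1).
  rewrite D linearZ /= !hornerXn expr1n expr0n subr0 => H.
  have a0 : (a.+1%:R : rat) != 0 by rewrite pnatr_eq0.
  rewrite expr0 mulr1 addn0 factS_rat fact0 mulr1.
  by apply: (mulfI a0); rewrite H; field; rewrite nat1r natf_neq0 a0.
have a0 : (a.+1%:R : rat) != 0 by rewrite pnatr_eq0.
have D : ('X^(a.+1) * (1 - 'X) ^+ b.+1 : {poly rat})^`()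
   = a.+1%:R *: ('X^a * (1 - 'X) ^+ b.+1) - b.+1%:R *: ('X^(a.+1) * (1 - 'X) ^+ b).
  rewrite derivM derivXn deriv_exp derivB derivX derivC !scaler_nat /=.
  by rewrite sub0r mulN1r mulNrn mulrN mulrnAl mulrnAr.
have B x : ('X^(a.+1) * (1 - 'X) ^+ b.+1 : {poly rat}).[x] = x ^+ a.+1 * (1 - x) ^+ b.+1.
  by rewrite !hornerE.
have := integral01_deriv ('X^(a.+1) * (1 - 'X) ^+ b.+1).
rewrite D linearB /= !linearZ /= IHb !B subrr !expr0n /= mulr0 mul0r subrr.
move=> /eqP; rewrite subr_eq0 => /eqP H.
apply: (mulfI a0); rewrite H addSnnS !factS_rat.
by field; rewrite natf_neq0 nat1r -natrD nat1r pnatr_eq0.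
Qed.

(** * Coefficients of the powers of [(exp t - 1) / t - 1] *)

(* [(exp t - 1) / t] modulo [t ^ N]. *)
Definition expq (N : nat) : {poly rat} := \poly_(i < N) (i.+1)`!%:R^-1.

(** ['X * expq N] truncates [exp t - 1]; differentiating it gives the equation, and the last term is
    what the truncation loses. *)
Lemma expq_ode (N : nat) :
  'X * (expq N)^`() + expq N = 'X * expq N + 1 - N`!%:R^-1 *: 'X^N.
Proof.
apply/polyP=> -[|i]; rewrite !(coefD, coefN, coefXM, coefZ, coefXn, coef1) /=.
  rewrite coef_poly; case: N => [|N] /=; rewrite ?fact0 ?mulr1 ?mulr0 ?invr1; ring.
rewrite coef_deriv !coef_poly addr0.
have [lt_iN|lt_Ni|->] := ltngtP i.+1 N.
- rewrite mulr0 subr0 -mulrSr -[_^-1 *+ _]mulr_natl factS_rat.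
  by rewrite invfM mulVKf // pnatr_eq0.
- by rewrite mul0rn mulr0 !subr0.
- by rewrite mul0rn mulr1 addr0 subrr.
Qed.

Definition expq1 (N : nat) : {poly rat} := expq N - 1.

Definition epow (N n k : nat) : rat := (expq1 N ^+ k)`_n.

(** Multiply the differential equation for [E] by [E ^+ k] and compare coefficients of [t^(n+1)],
    which lies below the truncation error [t^N]. *)
Lemma epow_rec (N n k : nat) : (n.+1 < N)%N ->
  (n + k).+2%:R * epow N n.+1 k.+1 = k.+1%:R * (epow N n k.+1 + epow N n k).
Proof.
move=> lt_nN; pose E := expq1 N.
have ode : 'X * E^`() + E = 'X * E + 'X - N`!%:R^-1 *: 'X^N.
  have := expq_ode N; rewrite -/E.
  have -> : expq N = E + 1 by rewrite subrK.
  rewrite derivD -polyC1 derivC addr0 => /(canRL (addrK _)).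
  by move: (E^`()) => E'; rewrite polyC1; move: (_ *: _) => t H; ring: H.
have odeX : 'X * (E^`() * E ^+ k) + E ^+ k.+1
    = 'X * E ^+ k.+1 + 'X * E ^+ k - 'X^N * (N`!%:R^-1 *: E ^+ k).
  by rewrite exprS !mulrA -mulrDl ode mulrBl mulrDl -scalerAl scalerAr.
have dE : epow N n.+1 k.+1 *+ n.+1 = (E^`() * E ^+ k)`_n *+ k.+1.
  by rewrite -coef_deriv deriv_exp coefMn mulrC.
have := congr1 (fun p : {poly rat} => p`_n.+1) odeX.
rewrite !(coefD, coefN, coefXM, coefXnM) lt_nN /= subr0 -!/(epow _ _ _) => <-.
rewrite mulrDr !mulr_natl -dE -mulrnDr.
by congr (_ *+ _); lia.
Qed.

(** [expq1 N] has no constant term, so its [k]-th power is divisible by ['X^k]. *)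
Lemma epow_lt (N n k : nat) : (0 < N)%N -> (n < k)%N -> epow N n k = 0.
Proof.
move=> N_gt0 lt_nk.
have /factor_theorem[q] : root (expq1 N) 0.
  by rewrite rootE horner_coef0 coefB coef_poly N_gt0 coef1 /= invr1 subrr.
by rewrite /epow subr0 => ->; rewrite exprMn coefMXn lt_nk.
Qed.

Lemma epow0S (N n : nat) : epow N n.+1 0 = 0.
Proof. by rewrite /epow expr0 coef1. Qed.

Lemma epow01 (N : nat) : epow N 0 0 = 1.
Proof. by rewrite /epow expr0 coef1. Qed.

(** * Bernoulli numbers and the logarithm of [(exp t - 1) / t] *)

(** [bernoulli_num_rec] divided by [(n+2)!], with the term of [B_0] moved to the right: the [t^n]
    coefficient of [q (log q)' = q'] for [q = (exp t - 1) / t]. *)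
Lemma bernoulli_fact_rec (n : nat) :
  \sum_(j < n.+1) bernoulli_num j.+1 / j.+1`!%:R * (n - j).+1`!%:R^-1
  = n.+1%:R / n.+2`!%:R.
Proof.
have := bernoulli_num_rec n.+1; rewrite big_ord_recl /= bin0 mul1r.
have -> : bernoulli_num 0 = 1 by rewrite /bernoulli_num /= big_ord0 mul0r subr0.
move/(canRL (addKr _)); rewrite -[n.+2%:R]nat1r addKr => <-.
rewrite mulr_suml; apply: eq_bigr => j _; rewrite /bump /=.
have le_jn : (j.+1 <= n.+2)%N by rewrite ltnS ltnW.
have b0 : 'C(n.+2, j.+1)%:R != 0 :> rat by rewrite pnatr_eq0 -lt0n bin_gt0.
have alg (x b f g : rat) : b != 0 -> f != 0 -> g != 0 ->
  x / f * g^-1 = b * x / (b * (f * g)) by move=> *; field; apply/and3P.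
rewrite -(bin_fact_rat _ _ le_jn) subSS subSn -1?ltnS //.
exact: (alg _ _ _ _ b0 (natf_neq0 _) (natf_neq0 _)).
Qed.

(* Both sides are [n]-th coefficients of the derivative of [log ((exp t - 1) / t)],
   divided by [n + 1]. *)
Lemma log_expq_coef (N n : nat) : (n.+1 < N)%N ->
  \sum_(k < N) (-1) ^+ k / k.+1%:R * epow N n.+1 k.+1
  = bernoulli_num n.+1 / (n.+1%:R * n.+1`!%:R).
Proof.
pose E := expq1 N.
(* A truncated geometric series for [E' / (1 + E)], the logarithmic derivative. *)
pose S : {poly rat} := \sum_(k < N) (-1) ^+ k *: (E ^+ k * E^`()).
have sE j : S`_j = j.+1%:R * \sum_(k < N) (-1) ^+ k / k.+1%:R * epow N j.+1 k.+1.
  rewrite coef_sum mulr_sumr; apply: eq_bigr => k _.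
  have -> : E ^+ k * E^`() = k.+1%:R^-1 *: (E ^+ k.+1)^`().
    by rewrite deriv_exp -scaler_nat scalerA mulVf ?pnatr_eq0 // scale1r mulrC.
  by rewrite !coefZ coef_deriv -/(epow _ _ _) -mulr_natl; ring.
have TS : expq N * S = E^`() - (- E) ^+ N * E^`().
  have -> : S = (\sum_(k < N) (- E) ^+ k) * E^`().
    rewrite mulr_suml; apply: eq_bigr => k _.
    by rewrite -[- E]scaleN1r exprZn scalerAl.
  have -> : expq N = - (- E - 1) by rewrite opprB opprK addrC subrK.
  by rewrite mulrA mulNr -subrX1 opprB mulrBl mul1r.
have rec m : (m.+1 < N)%N ->
    \sum_(j < m.+1) S`_j * (m - j).+1`!%:R^-1 = m.+1%:R / m.+2`!%:R.
  move=> lt_mN.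
  have := congr1 (fun p : {poly rat} => p`_m) TS; rewrite mulrC coefM.
  have -> : (E^`() - (- E) ^+ N * E^`())`_m = m.+1%:R / m.+2`!%:R.
    have [F ->] : exists F, - E = F * 'X.
      have /factor_theorem[F] : root (- E) 0.
        rewrite rootE hornerN oppr_eq0 horner_coef0 coefB coef_poly coef1.
        by rewrite (ltn_trans _ lt_mN) //= invr1 subrr.
      by rewrite subr0; exists F.
    rewrite exprMn mulrAC coefB coefMXn ltnW // subr0 coef_deriv coefB coef1 coef_poly.
    by rewrite lt_mN subr0 mulr_natl.
  move=> <-; apply: eq_bigr => j _.
  by rewrite coef_poly (leq_ltn_trans (leq_subr _ _)) // ltnW.
suff sB j : (j.+1 < N)%N -> S`_j = bernoulli_num j.+1 / j.+1`!%:R.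
  move=> lt_nN; apply: (@mulfI _ n.+1%:R); first by rewrite pnatr_eq0.
  by rewrite -sE sB // invfM mulrCA mulVKf // pnatr_eq0.
(* The constant term of [expq N] is 1, so the convolution determines each coefficient of [S] from
   the earlier ones. *)
elim/ltn_ind: j => j IHj lt_jN.
have := rec j lt_jN; rewrite -bernoulli_fact_rec !big_ord_recr /= subnn invr1 !mulr1.
rewrite (eq_bigr (fun i : 'I_j => bernoulli_num i.+1 / i.+1`!%:R * (j - i).+1`!%:R^-1)).
  by move/addrI.
by move=> i _; rewrite IHj // (ltn_trans _ lt_jN) // ltnS.
Qed.

(** * Telescoping to the Bernoulli number *)

Lemma sum_shift (V : zmodType) (a : nat -> V) (N : nat) : a 0%N = 0 -> a N = 0 ->
  \sum_(k < N) a k.+1 = \sum_(k < N) a k.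
Proof.
move=> a0 aN; transitivity (\sum_(k < N.+1) a k).
  by rewrite big_ord_recl a0 add0r.
by rewrite big_ord_recr /= aN addr0.
Qed.

Lemma sum_epow_bernoulli (N n : nat) : (n.+2 < N)%N ->
  \sum_(k < N) (-1) ^+ k.+1 * epow N n.+1 k / ((n + k).+2%:R * (n + k).+3%:R)
  = bernoulli_num n.+2 / (n.+2%:R * n.+2`!%:R).
Proof.
move=> lt_nN; rewrite -(log_expq_coef N) //.
have N_gt0 : (0 < N)%N by apply: leq_trans lt_nN.
(* By [epow_rec] and partial fractions, the [k]-th terms of the two sums differ by [a k - a k.+1];
   the end values of [a] vanish. *)
pose a k := (-1) ^+ k.+1 * epow N n.+1 k / (n + k).+2%:R.
have aS : \sum_(k < N) a k.+1 = \sum_(k < N) a k.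
  apply: (@sum_shift _ a); first by rewrite /a epow0S mulr0 mul0r.
  by rewrite /a epow_lt ?mulr0 ?mul0r // (ltn_trans _ lt_nN).
apply: (addIr (\sum_(k < N) a k.+1)); rewrite {2}aS -!big_split /=.
apply: eq_bigr => k _; have := epow_rec N n.+1 k lt_nN.
move: (epow N n.+2 k.+1) => e2; rewrite /a addSn addnS => H.
have -> : e2 = k.+1%:R * (epow N n.+1 k.+1 + epow N n.+1 k) / (n + k).+3%:R.
  by rewrite -H mulrC mulKf // pnatr_eq0.
move: (epow N n.+1 k.+1) (epow N n.+1 k) => x y; rewrite !exprS.
by field; rewrite nat1r -!natrD !pnatr_eq0.
Qed.

(** * Two expansions generated by the operator [x (1 - x)^2 d/dx] *)

Lemma euler_op (a b : nat) :
  'X * (1 - 'X) ^+ 2 * ('X^a * (1 - 'X) ^+ b)^`()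
  = a%:R *: ('X^a * (1 - 'X) ^+ b.+2) - b%:R *: ('X^(a.+1) * (1 - 'X) ^+ b.+1)
  :> {poly rat}.
Proof.
rewrite derivM derivXn deriv_exp derivB derivX derivC sub0r !scaler_nat.
by case: a b => [|a] [|b]; rewrite /= ?exprS; ring.
Qed.

Lemma eulerian2_eq0 (n : nat) (k : int) : (k < 0) || (n%:Z < k) -> eulerian2 n k = 0.
Proof.
elim: n k => [|n IHn] k hk /=.
  by case: eqP hk => // ->.
by rewrite !IHn ?mulr0 //; lia.
Qed.

(** For [n < N] this is [R_n]: where [2 * n - k] would truncate, [eulerian2 n k] is 0. *)
Definition eulerian2_poly (N n : nat) : {poly rat} :=
  \sum_(k < N) ((-1) ^+ k * (eulerian2 n k%:Z)%:~R) *: ('X^(k.+1) * (1 - 'X) ^+ (2 * n - k)).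

Lemma eulerian2_poly_rec (N n : nat) : (n.+1 < N)%N ->
  eulerian2_poly N n.+1 = 'X * (1 - 'X) ^+ 2 * (eulerian2_poly N n)^`().
Proof.
move=> lt_nN.
(* The share of the second summand of the Eulerian recurrence; shifted by one, it matches the second
   term of [euler_op]. *)
pose b (k : nat) : {poly rat} :=
  ((-1) ^+ k * (((2 * n + 1)%N%:Z - k%:Z) * eulerian2 n (k%:Z - 1))%:~R) *:
    ('X^(k.+1) * (1 - 'X) ^+ (2 * n.+1 - k)).
have bS : \sum_(k < N) b k.+1 = \sum_(k < N) b k.
  by apply: sum_shift; rewrite /b eulerian2_eq0 ?mulr0 ?scale0r //; lia.
transitivity (\sum_(k < N) (((-1) ^+ k * (k.+1%:R * (eulerian2 n k%:Z)%:~R)) *: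
    ('X^(k.+1) * (1 - 'X) ^+ (2 * n.+1 - k)) + b k)).
  apply: eq_bigr => k _; rewrite -scalerDl -mulrDr; congr ((_ * _) *: _).
  by rewrite /= rmorphD rmorphM /= -natr1; congr (_ * _ + _); rewrite rmorphD.
rewrite big_split /= -bS -big_split /= raddf_sum mulr_sumr.
apply: eq_bigr => k _.
rewrite [poly_deriv__canonical__Algebra_Additive _ _]derivZ -scalerAr euler_op /b.
have [lt_nk|le_kn] := ltnP n k.
  have E0 : eulerian2 n k = 0 by rewrite eulerian2_eq0 //; lia.
  have -> : k.+1%:Z - 1 = k by lia.
  by rewrite E0 !(mulr0, scale0r) addr0.
have -> : k.+1%:Z - 1 = k by lia.
have -> : (2 * n.+1 - k = (2 * n - k).+2)%N by lia.
have -> : (2 * n.+1 - k.+1 = (2 * n - k).+1)%N by lia.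
have -> : (2 * n + 1)%N%:Z - k.+1%:Z = (2 * n - k)%N%:Z by lia.
rewrite scalerBr !scalerA -scaleNr rmorphM /=.
congr (_ *: _ + _ *: _); first by rewrite mulrA mulrAC.
by rewrite -pmulrn exprS mulN1r mulNr [_%:R * _]mulrC mulrA.
Qed.

(* Up to sign, the Ward numbers (associated Stirling numbers of the second kind). *)
Definition ward (N n k : nat) : rat :=
  (-1) ^+ k.+1 * ((n + k)`!%:R / k`!%:R) * epow N n k.

(** The weight [(n+k)! / k!] absorbs the factor [n + k + 2] of [epow_rec]. *)
Lemma ward_rec (N n k : nat) : (n.+1 < N)%N ->
  ward N n.+1 k.+1 = k.+1%:R * ward N n k.+1 - (n + k).+1%:R * ward N n k.
Proof.
move=> /(epow_rec N n k) H; rewrite /ward addSn addnS !factS_rat.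
have g0 := natf_neq0 k; have k0 : k.+1%:R != 0 :> rat by rewrite pnatr_eq0.
have alg (s m2 m1 f q g e2 e1 e0 : rat) : q != 0 -> g != 0 -> m2 * e2 = q * (e1 + e0) ->
    s * (m2 * (m1 * f) / (q * g)) * e2
    = q * (s * (m1 * f / (q * g)) * e1) - m1 * (- s * (f / g) * e0).
  move=> q0 g_neq0 He; rewrite [LHS](_ : _ = s * (m1 * f / (q * g)) * (m2 * e2)).
    by rewrite He; field; apply/andP.
  by ring.
rewrite (_ : (-1) ^+ k.+1 = - (-1) ^+ k.+2); last by rewrite [in RHS]exprS mulN1r opprK.
exact: alg.
Qed.

Definition epow_poly (N n : nat) : {poly rat} :=
  \sum_(k < N) ward N n k *: ('X^k * (1 - 'X) ^+ n.+1).

Lemma epow_poly_rec (N n : nat) : (n.+1 < N)%N ->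
  epow_poly N n.+1 = 'X * (1 - 'X) ^+ 2 * (epow_poly N n)^`().
Proof.
move=> lt_nN; have N_gt0 : (0 < N)%N by apply: leq_trans lt_nN.
pose p (c : nat -> rat) (k : nat) : {poly rat} := c k *: ('X^k * (1 - 'X) ^+ n.+2).
have pS c : c 0%N = 0 -> c N = 0 -> \sum_(k < N) p c k = \sum_(k < N) p c k.+1.
  by move=> c0 cN; rewrite sum_shift // /p ?c0 ?cN scale0r.
have wardN m : (m < N)%N -> ward N m N = 0.
  by move=> lt_mN; rewrite /ward epow_lt ?mulr0.
have ward0 : ward N n.+1 0 = 0 by rewrite /ward epow0S mulr0.
rewrite /epow_poly raddf_sum mulr_sumr.
transitivity (\sum_(k < N) p (fun k => k%:R * ward N n k) k
   - \sum_(k < N) ((n + k).+1%:R * ward N n k) *: ('X^(k.+1) * (1 - 'X) ^+ n.+2)).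
  rewrite [LHS](pS (ward N n.+1)) ?wardN ?ward0 //.
  rewrite (pS (fun k => k%:R * ward N n k)) ?mul0r ?wardN ?mulr0 1?ltnW //.
  rewrite -sumrB.
  by apply: eq_bigr => k _; rewrite /p ward_rec // scalerBl.
rewrite -sumrB; apply: eq_bigr => k _.
rewrite [poly_deriv__canonical__Algebra_Additive _ _]derivZ -scalerAr euler_op /p.
move: (ward N n k) => w.
rewrite [k%:R * _]mulrC [_.+1%:R * _]mulrC -!scalerA -scalerBr; congr (_ *: _).
have -> : (n + k).+1%:R = k%:R + n.+1%:R :> rat by rewrite -natrD addnC addnS addnC.
rewrite scalerDl opprD addrA -scalerBr; congr (_ *: _ - _).
by rewrite ['X^(k.+1)]exprSr [_ ^+ n.+3]exprS; ring.
Qed.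

Lemma eulerian2_polyE (N n : nat) : (n.+1 < N)%N ->
  eulerian2_poly N n.+1 = epow_poly N n.+1.
Proof.
elim: n => [|n IHn] lt_nN; last first.
  by rewrite eulerian2_poly_rec // IHn 1?ltnW // -epow_poly_rec.
(* At index 0 the two polynomials are ['X] and ['X - 1]: only their derivatives agree, so equality
   starts at index 1. *)
rewrite eulerian2_poly_rec // epow_poly_rec //; congr (_ * _).
case: N lt_nN => // N lt_nN.
rewrite /eulerian2_poly /epow_poly !big_ord_recl /= !big1 ?addr0.
- rewrite /ward epow01 fact0 /= expr1 expr0 divr1 !mulr1 mul1r.
  by rewrite scale1r scaleN1r !derivE; ring.
- by move=> k _; rewrite /ward epow_lt ?mulr0 ?scale0r.
- by move=> k _; rewrite mulr0 scale0r.
Qed.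

Theorem theorem7p2 (n : nat) :
  \sum_(0 <= k < n.+1)
    (-1) ^+ k * (eulerian2 n k%:Z)%:~R * ('C(2 * n + 1, k + 1)%:R)^-1
  = 2 * bernoulli_num n.+1 :> rat.
Proof.
case: n => [|n].
  by rewrite big_nat1 bernoulli_num1 mulfV ?pnatr_eq0 //= bin1 expr0 !mul1r invr1.
(* The least bound that [sum_epow_bernoulli] admits. *)
pose N := n.+3.
have -> : \sum_(0 <= k < n.+2)
    (-1) ^+ k * (eulerian2 n.+1 k%:Z)%:~R * ('C(2 * n.+1 + 1, k + 1)%:R)^-1
  = (2 * n.+2)%:R * integral01 (eulerian2_poly N n.+1).
  rewrite big_mkord (big_ord_widen N (fun k =>
    (-1) ^+ k * (eulerian2 n.+1 k%:Z)%:~R * ('C(2 * n.+1 + 1, k + 1)%:R)^-1)) //.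
  rewrite big_mkcond linear_sum mulr_sumr; apply: eq_bigr => k _.
  case: ltnP => [lt_kn|le_nk]; last first.
    by rewrite eulerian2_eq0 ?mulr0 ?scale0r ?linear0 ?mulr0 //; lia.
  move: (eulerian2 _ _) => e; rewrite linearZ /= beta01.
  rewrite mulrCA; congr (_ * _).
  have le_k : (k.+1 <= 2 * n.+1 + 1)%N by lia.
  have alg (b f g m : rat) : b != 0 -> f != 0 -> g != 0 -> m != 0 ->
    b^-1 = m * (f * g / (m * (b * (f * g)))).
    by move=> b0 f0 g0 m0; field; rewrite b0 f0 g0 m0.
  have -> : ((k.+1 + (2 * n.+1 - k)).+1 = (2 * n.+1 + 1).+1)%N by lia.
  have -> : (2 * n.+2 = (2 * n.+1 + 1).+1)%N by lia.
  have -> : (2 * n.+1 - k = 2 * n.+1 + 1 - k.+1)%N by lia.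
  rewrite (factS_rat (2 * n.+1 + 1)) -(bin_fact_rat _ _ le_k) [(k + 1)%N]addn1.
  by apply: alg; rewrite ?natf_neq0 // pnatr_eq0 // -lt0n bin_gt0.
(* The beta values cancel the weights in [ward], leaving [(n+2)! / ((n+k+2) (n+k+3))]. *)
have int_epow : integral01 (epow_poly N n.+1)
    = n.+2`!%:R * (bernoulli_num n.+2 / (n.+2%:R * n.+2`!%:R)).
  rewrite -(sum_epow_bernoulli N) // linear_sum mulr_sumr; apply: eq_bigr => k _.
  rewrite linearZ /= beta01 /ward.
  have -> : ((k + n.+2).+1 = (n + k).+3)%N by lia.
  rewrite addSn (factS_rat (n + k).+2) (factS_rat (n + k).+1).
  have alg (s f g h e m1 m2 : rat) : f != 0 -> g != 0 -> m1 != 0 -> m2 != 0 ->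
    s * (f / g) * e * (g * h / (m2 * (m1 * f))) = h * (s * e / (m1 * m2)).
    by move=> f0 g0 m10 m20; field; rewrite f0 g0 m10 m20.
  by apply: alg; rewrite ?natf_neq0 ?pnatr_eq0.
rewrite eulerian2_polyE // int_epow natrM -mulrA; congr (_ * _).
have m0 : n.+2%:R != 0 :> rat by rewrite pnatr_eq0.
by rewrite mulrA mulrC divfK // mulf_neq0 ?natf_neq0.
Qed.
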